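(* Let $n,p\ge1$, $X_1,\dots,X_n\in\mathbb{R}^p$, $Y_1,\dots,Y_n\in\mathbb{R}$, let $\psi:\mathbb{R}\to\mathbb{R}$ be a differentiable convex function, and let $L(\beta)=\frac1n\sum_{i=1}^n\big(\psi(X_i^T\beta)-Y_iX_i^T\beta\big)$ for $\beta\in\mathbb{R}^p$. Let $\beta^*\in\mathbb{R}^p$ and $S=\mathrm{supp}(\beta^* )$. Let $\lambda>0$ and let $h_\lambda:\mathbb{R}\to\mathbb{R}$ be a convex differentiable function such that (i) $\sup_{t\in\mathbb{R}}|h'_\lambda(t)|\le\lambda$; (ii) $h_\lambda(-t)=h_\lambda(t)$ for all $t$; (iii) $h_\lambda'$ is monotonically increasing and there are constants $\eta^-\ge\eta^+\ge0$ with $\eta^+\le\frac{h_\lambda'(t_2)-h_\lambda'(t_1)}{t_2-t_1}\le\eta^-$ for all $t_2>t_1$; (iv) $h_\lambda(0)=h'_\lambda(0)=0$. Let $\hat\beta$ be a d-stationary point on $\mathbb{R}^p$ of $$F(\beta)=L(\beta)+\lambda\|\beta\|_1-\sum_{i=1}^p h_\lambda(\beta_i).$$ Let $c\in(0,1)$ and assume: (a) $\|\nabla L(\beta^* )\|_\infty\le\frac{\lambda}{8}$; (b) $\max_{j\in S^c}|h'_\lambda(\hat\beta_j)|\le(1-c)\lambda$; (c) there is $\gamma>0$ such that, with $\mathcal{C}=\{\nu\in\mathbb{R}^p:\ \|\nu_{S^c}\|_1\le\frac{4+c}{c}\|\nu_S\|_1\}$, $$L(\beta_1)\ge L(\beta_2)+\nabla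 L(\beta_2)^T(\beta_1-\beta_2)+\frac{\gamma}{2}\|\beta_1-\beta_2\|_2^2$$ for all $\beta_1,\beta_2\in\mathbb{R}^p$ with $\beta_1-\beta_2\in\mathcal{C}$; (d) $\gamma>\eta^-$; (e) $\Big\|\frac1n\sum_{i=1}^n\big(\psi'(X_i^T\beta^* )X_i-Y_iX_i\big)\Big\|_\infty\le\frac{c\lambda}{2}$. Then $$\|\beta^*-\hat\beta\|_2\le\frac{17\lambda}{8(\gamma-\eta^-)}\sqrt{|S|}.$$
   Context: The setting is that of generalized linear models: $\psi$ is the (univariate convex) cumulant function of an exponential family with density proportional to $\exp\{(YX^T\beta^*-\psi(X^T\beta^* ))/c(\sigma)\}$, and $L$ is the sample average of the negative log-likelihood. $\mathrm{supp}(\beta)=\{i:\beta_i\ne0\}$; $S^c$ is the complement of $S$ in $\{1,\dots,p\}$; $\nu_S$ is the subvector of $\nu$ indexed by $S$. The directional derivative of $F$ at $\beta_0$ in direction $\beta-\beta_0$ is $F'(\beta_0;\beta-\beta_0)=\lim_{\tau\to0+}\frac{F(\beta_0+\tau(\beta-\beta_0))-F(\beta_0)}{\tau}$. A point $\hat\beta$ is a d-stationary point of $F$ on $\mathbb{R}^p$ if $F'(\hat\beta;\beta-\hat\beta)\ge0$ for all $\beta\in\mathbb{R}^p$. *)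

(* Defs.v *)
From HB Require Import structures.
From mathcomp Require Import all_boot all_order all_algebra.
From mathcomp Require Import all_classical all_reals all_analysis.

Set Implicit Arguments.
Unset Strict Implicit.
Unset Printing Implicit Defensive.

Import Order.TTheory GRing.Theory Num.Theory.
Import numFieldNormedType.Exports.

Local Open Scope classical_set_scope.
Local Open Scope ring_scope.

Section Defs.
Context {R : realType}.

Definition dotv {p : nat} (u v : 'cV[R]_p) : R := \sum_(j < p) u j 0 * v j 0.

Definition l1norm {p : nat} (v : 'cV[R]_p) : R := \sum_(j < p) `|v j 0|.

Definition l2norm {p : nat} (v : 'cV[R]_p) : R :=
  Num.sqrt (\sum_(j < p) v j 0 ^+ 2).

(* The library norm on matrices is the maximum of the absolute values of the
   entries. *)
Definition linfnorm {p : nat} (v : 'cV[R]_p) : R := `|v|.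

Definition supp {p : nat} (b : 'cV[R]_p) : {set 'I_p} :=
  [set j | b j 0 != 0]%SET.

Definition subvec {p : nat} (S : {set 'I_p}) (v : 'cV[R]_p) : 'cV[R]_#|S| :=
  \col_(k < #|S|) v (enum_val k) 0.

Definition gradient {p : nat} (f : 'cV[R]_p -> R) (b : 'cV[R]_p) : 'cV[R]_p :=
  \col_(j < p) 'D_(delta_mx j 0) f b.

Definition diff_quotient {p : nat} (F : 'cV[R]_p -> R) (b0 d : 'cV[R]_p)
    (tau : R) : R :=
  (F (b0 + tau *: d) - F b0) / tau.

Definition dirderiv {p : nat} (F : 'cV[R]_p -> R) (b0 d : 'cV[R]_p) : R :=
  lim (diff_quotient F b0 d tau @[tau --> 0^'+]).

(* [lim] is total, so the existence of the limit is part of the notion. *)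
Definition d_stationary {p : nat} (F : 'cV[R]_p -> R) (bhat : 'cV[R]_p) : Prop :=
  forall b : 'cV[R]_p,
    cvg (diff_quotient F bhat (b - bhat) tau @[tau --> 0^'+]) /\
    0 <= dirderiv F bhat (b - bhat).

Definition glm_loss {n p : nat} (X : 'I_n -> 'cV[R]_p) (Y : 'I_n -> R)
    (psi : R -> R) (b : 'cV[R]_p) : R :=
  n%:R^-1 * \sum_(i < n) (psi (dotv (X i) b) - Y i * dotv (X i) b).

Definition penalized_loss {p : nat} (L : 'cV[R]_p -> R) (lambda : R)
    (h : R -> R) (b : 'cV[R]_p) : R :=
  L b + lambda * l1norm b - \sum_(j < p) h (b j 0).

Definition cone {p : nat} (S : {set 'I_p}) (c : R) : set 'cV[R]_p :=
  [set nu | l1norm (subvec (~: S)%SET nu) <=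
            (4 + c) / c * l1norm (subvec S nu)].

End Defs.

(* Main.v *)
Require Import Defs.
From HB Require Import structures.
From mathcomp Require Import all_boot all_order all_algebra.
From mathcomp Require Import all_classical all_reals all_analysis.
From mathcomp Require Import ring lra.
Import Order.TTheory GRing.Theory Num.Theory.
Import numFieldNormedType.Exports.
Local Open Scope classical_set_scope.
Local Open Scope ring_scope.

(* Write D = betahat - betastar.  Stationarity in the direction -D, where
   convexity bounds the l1 part of every difference quotient by
   |betastar|_1 - |betahat|_1, gives
     (grad L betahat - grad L betastar) . D <= sum_j T_j,
     T_j = - (grad L betastar)_j D_j + lambda (|betastar_j| - |betahat_j|)
           + h'(betahat_j) D_j.
   The left side is nonnegative since L is convex; by (b) and (e),
   T_j <= (4 + c)/2 lambda |D_j| on S and T_j <= - c/2 lambda |D_j| off S,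
   so D is in the cone.  Restricted strong convexity, applied in both directions,
   now bounds the left side below by gamma |D|_2^2.  On the other hand, splitting
   h'(betahat_j) = (h'(betahat_j) - h'(betastar_j)) + h'(betastar_j) and using (a),
   T_j <= eta_minus D_j^2 + 17/8 lambda |D_j| on S and T_j <= eta_minus D_j^2
   off S; Cauchy-Schwarz on S concludes. *)

(** * One-variable calculus, convexity and Cauchy-Schwarz *)

Section Real_functions.
Context {R : realType}.

(** Chain rule along the affine map [t |-> a + t * e]; it supplies the limit of each summand, of the
    loss and of [h], when a vector moves along a line. *)
Lemma cvg_slope_line (f : R -> R) (a e : R) : derivable f a 1 ->
  t^-1 * (f (a + t * e) - f a) @[t --> 0^'] --> derive1 f a * e.
Proof.
move=> df.
pose g : R -> R := cst a + id * cst e.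
have dg : is_derive (0 : R) 1 g e.
  apply: is_derive_eq.
  by rewrite add0r scaler0 add0r [e *: 1]mulr1.
have df' : is_derive (g 0) 1 f (derive1 f a).
  rewrite (_ : g 0 = a) ?derive1E; last by rewrite /g !fctE mul0r addr0.
  exact: derivableP.
have := @is_derive1_comp R f g 0 _ _ df' dg.
case=> cv <-; move: cv; rewrite /derivable /derive => cv.
apply: cvg_trans (cv).
apply: near_eq_cvg; near=> t => /=.
rewrite /g !fctE addr0 mul0r addr0 [t%R%:A]mulr1.
by [].
Unshelve. all: end_near.
Qed.

Lemma cvg_slope_line_right (f : R -> R) (a e : R) : derivable f a 1 ->
  t^-1 * (f (a + t * e) - f a) @[t --> 0^'+] --> derive1 f a * e.
Proof. by move=> df; apply: cvg_dnbhs_at_right; exact: cvg_slope_line. Qed.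

(** For [t] in (0, 1], convexity on the segment from [x] to [y] bounds the slope by [f y - f x]; the
    bound survives the limit at 0. *)
Lemma convex_tangent_le (f : R -> R) (x y : R) :
  convex_function (E := R^o) [set: R^o] f -> derivable f x 1 ->
  derive1 f x * (y - x) <= f y - f x.
Proof.
move=> cf df.
apply: (cvgr_to_le (cvg_slope_line_right f x (y - x) df)).
near=> t.
have t0 : 0 < t by [].
have t1 : t <= 1 by near: t; exact: nbhs_right_le.
rewrite mulrC ler_pdivrMr//.
have := cf (Itv01 (ltW t0) t1) y x (in_setT _) (in_setT _).
rewrite !convRE /= => le_f.
have <- : t * y + (1 - t) * x = x + t * (y - x) by ring.
by move: le_f; rewrite /unstable.onem; lra.
Unshelve. all: end_near.
Qed.

(** Sum of the tangent inequalities at [x] and at [y]. *)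
Lemma convex_derive1_monotone (f : R -> R) (x y : R) :
  convex_function (E := R^o) [set: R^o] f -> (forall t, derivable f t 1) ->
  0 <= (derive1 f y - derive1 f x) * (y - x).
Proof.
move=> cf df.
have := convex_tangent_le f x y cf (df x).
have := convex_tangent_le f y x cf (df y).
lra.
Qed.

(** [a + t * e] is a convex combination of [a] and [a + e], so the triangle inequality suffices,
    even at [a = 0], where the absolute value has no derivative. *)
Lemma normr_slope_le (a e t : R) : 0 < t -> t <= 1 ->
  t^-1 * (`|a + t * e| - `|a|) <= `|a + e| - `|a|.
Proof.
move=> t0 t1; rewrite mulrC ler_pdivrMr//.
have -> : a + t * e = (1 - t) * a + t * (a + e) by ring.
have := ler_normD ((1 - t) * a) (t * (a + e)).
rewrite !normrM (gtr0_norm t0) (ger0_norm (_ : 0 <= 1 - t)) ?subr_ge0//.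
lra.
Qed.

Lemma sum_normr_le_sqrt {I : finType} (A : {set I}) (v : I -> R) :
  \sum_(j in A) `|v j| <=
    Num.sqrt #|A|%:R * Num.sqrt (\sum_(j in A) v j ^+ 2).
Proof.
set s := \sum_(j in A) _; set q := \sum_(j in A) _ ^+ 2.
have q0 : 0 <= q by apply: sumr_ge0 => j _; rewrite sqr_ge0.
have s0 : 0 <= s by apply: sumr_ge0.
have [A0|A0] := eqVneq #|A| 0%N.
  suff -> : s = 0 by rewrite mulr_ge0 ?sqrtr_ge0.
  by rewrite /s (cards0_eq A0) big_set0.
have m0 : 0 < #|A|%:R :> R by rewrite ltr0n lt0n.
rewrite -sqrtrM ?ler0n// -[leLHS](ger0_norm s0) -sqrtr_sqr ler_wsqrtr//.
rewrite -(ler_pM2l m0) -subr_ge0.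
(* The defect in Cauchy-Schwarz is a sum of squared deviations from the mean, scaled by [#|A|] to
   avoid division. *)
have -> : #|A|%:R * (#|A|%:R * q) - #|A|%:R * s ^+ 2
    = \sum_(j in A) (#|A|%:R * `|v j| - s) ^+ 2.
  under [RHS]eq_bigr => j _.
    rewrite (_ : _ ^+ 2 = #|A|%:R ^+ 2 * v j ^+ 2
        - 2 * #|A|%:R * s * `|v j| + s ^+ 2); last first.
      by rewrite -(real_normK (num_real (v j))); ring.
    over.
  rewrite big_split sumrB -!mulr_sumr sumr_const -[s *+ _]mulr_natl /= -/s -/q.
  ring.
by apply: sumr_ge0 => j _; rewrite sqr_ge0.
Qed.

End Real_functions.

(** * Gradient of the loss and first-order consequence of stationarity *)

Section Generalized_linear_model.
Context {R : realType} {p : nat}.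
Implicit Types (u v b d : 'cV[R]_p).

Lemma dotv_delta_mx v j : dotv v (delta_mx j 0) = v j 0.
Proof.
rewrite /dotv (bigD1 j)//= big1 ?addr0; first by rewrite mxE !eqxx mulr1.
by move=> k /negbTE kj; rewrite mxE kj mulr0.
Qed.

Lemma dotvDZ u b d (t : R) : dotv u (b + t *: d) = dotv u b + t * dotv u d.
Proof.
rewrite /dotv mulr_sumr -big_split; apply: eq_bigr => j _ /=.
by rewrite !mxE; ring.
Qed.

Lemma dotvB u b d : dotv u (b - d) = dotv u b - dotv u d.
Proof.
by rewrite -[in LHS](scale1r d) -scaleNr dotvDZ mulN1r.
Qed.

Lemma abs_coord_le_linfnorm v j : `|v j 0| <= linfnorm v.
Proof.
rewrite /linfnorm [leRHS]/Num.Def.normr /= mx_normrE.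
exact: (le_bigmax _ (fun ij => `|v ij.1 ij.2|) (j, 0)).
Qed.

Lemma l1norm_subvec (A : {set 'I_p}) v :
  l1norm (subvec A v) = \sum_(j in A) `|v j 0|.
Proof.
rewrite /l1norm [RHS]big_enum_val; apply: eq_bigr => k _.
by rewrite mxE.
Qed.

Context {n : nat} (X : 'I_n -> 'cV[R]_p) (Y : 'I_n -> R) (psi : R -> R).
Hypothesis psi_diff : forall t : R, derivable psi t 1.
Hypothesis psi_convex : convex_function (E := R^o) [set: R^o] psi.

(** The closed form of the gradient, in the shape of the vector bounded by [h_e]. *)
Definition glm_score b : 'cV[R]_p :=
  n%:R^-1 *: \sum_(i < n) (derive1 psi (dotv (X i) b) *: X i - Y i *: X i).

Lemma dotv_glm_score b d : dotv (glm_score b) d =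
  n%:R^-1 * \sum_(i < n) (derive1 psi (dotv (X i) b) - Y i) * dotv (X i) d.
Proof.
rewrite /dotv /glm_score.
under eq_bigr do rewrite mxE summxE -mulrA.
rewrite -mulr_sumr; congr (_ * _).
under eq_bigr do rewrite mulr_suml.
rewrite exchange_big; apply: eq_bigr => i _ /=.
rewrite mulr_sumr; apply: eq_bigr => j _.
by rewrite !mxE; ring.
Qed.

(** The limit is two-sided, so it yields both the partial derivatives and the one-sided derivative
    used for stationarity. *)
Lemma cvg_glm_loss_slope b d :
  t^-1 * (glm_loss X Y psi (b + t *: d) - glm_loss X Y psi b) @[t --> 0^']
    --> dotv (glm_score b) d.
Proof.
rewrite dotv_glm_score.
have cv : n%:R^-1 * (\sum_(i < n) (t^-1 *
      (psi (dotv (X i) b + t * dotv (X i) d) - psi (dotv (X i) b))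
    - Y i * dotv (X i) d)) @[t --> 0^'] -->
  n%:R^-1 * \sum_(i < n) (derive1 psi (dotv (X i) b) - Y i) * dotv (X i) d.
  apply: cvgMl_tmp; apply: cvg_big => [|i _]; first exact: add_continuous.
  rewrite mulrBl; apply: cvgB; last exact: cvg_cst.
  exact: cvg_slope_line.
apply: cvg_trans cv; apply: near_eq_cvg; near=> t.
have t0 : t != 0 by near: t; exact: nbhs_dnbhs_neq.
rewrite /glm_loss -mulrBr mulrCA -sumrB; congr (_ * _).
rewrite mulr_sumr; apply: eq_bigr => i _.
by rewrite dotvDZ; field.
Unshelve. all: end_near.
Qed.

Lemma gradient_glm_loss b : gradient (glm_loss X Y psi) b = glm_score b.
Proof.
apply/colP => j; rewrite mxE -dotv_delta_mx /derive.
apply/cvg_lim => //.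
under eq_fun do rewrite /= (addrC _ b).
exact: cvg_glm_loss_slope.
Qed.

(** Observation by observation, this is the monotonicity of [derive1 psi] between [dotv (X i) d] and
    [dotv (X i) b]. *)
Lemma gradient_glm_loss_monotone b d :
  0 <= dotv (gradient (glm_loss X Y psi) b) (b - d)
     - dotv (gradient (glm_loss X Y psi) d) (b - d).
Proof.
rewrite !gradient_glm_loss !dotv_glm_score -mulrBr -sumrB.
rewrite mulr_ge0 ?invr_ge0// sumr_ge0// => i _.
rewrite -mulrBl dotvB.
have := convex_derive1_monotone psi (dotv (X i) d) (dotv (X i) b) psi_convex psi_diff.
by lra.
Qed.

Lemma d_stationary_ineq (lambda : R) (h : R -> R) bhat b :
  0 <= lambda -> (forall t : R, derivable h t 1) ->
  d_stationary (penalized_loss (glm_loss X Y psi) lambda h) bhat ->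
  0 <= dotv (gradient (glm_loss X Y psi) bhat) (b - bhat)
     + lambda * (l1norm b - l1norm bhat)
     - \sum_(j < p) derive1 h (bhat j 0) * (b j 0 - bhat j 0).
Proof.
move=> lambda0 h_diff /(_ b)[cF dF]; apply: le_trans dF _.
set L := glm_loss X Y psi; set d := b - bhat.
(* This majorant of the difference quotient has a constant in place of the l1 slope, so its limit is
   explicit; [cF] then allows the two limits to be compared. *)
have cvU : t^-1 * (L (bhat + t *: d) - L bhat)
    + lambda * (l1norm b - l1norm bhat)
    - \sum_(j < p) t^-1 * (h (bhat j 0 + t * d j 0) - h (bhat j 0))
    @[t --> 0^'+] -->
  dotv (gradient L bhat) d + lambda * (l1norm b - l1norm bhat)
    - \sum_(j < p) derive1 h (bhat j 0) * d j 0.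
  apply: cvgB; first apply: cvgD; last first.
  - by apply: cvg_big => [|j _]; [exact: add_continuous|exact: cvg_slope_line_right].
  - exact: cvg_cst.
  - apply: cvg_dnbhs_at_right; rewrite gradient_glm_loss.
    exact: cvg_glm_loss_slope.
rewrite (_ : \sum_(j < p) _ = \sum_(j < p) derive1 h (bhat j 0) * d j 0);
  last by apply: eq_bigr => j _; rewrite !mxE.
apply: (ler_cvg_to cF cvU); near=> t.
have t0 : 0 < t by [].
have t1 : t <= 1 by near: t; exact: nbhs_right_le.
have l1_slope : t^-1 * (l1norm (bhat + t *: d) - l1norm bhat)
    <= l1norm b - l1norm bhat.
  rewrite /l1norm -!sumrB mulr_sumr; apply: ler_sum => j _.
  have -> : b j 0 = bhat j 0 + d j 0 by rewrite !mxE; ring.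
  by rewrite !mxE -/(_ j _) normr_slope_le.
rewrite /diff_quotient /penalized_loss -/L -/d -mulr_sumr.
have -> : \sum_(j < p) (h (bhat j 0 + t * d j 0) - h (bhat j 0))
   = \sum_(j < p) h ((bhat + t *: d) j 0) - \sum_(j < p) h (bhat j 0).
  by rewrite -sumrB; apply: eq_bigr => j _; rewrite !mxE.
have := ler_wpM2l lambda0 l1_slope.
by lra.
Unshelve. all: end_near.
Qed.

End Generalized_linear_model.

(** * The error bound *)

Theorem theorem5p1 (R : realType) (n p : nat)
  (hn : (1 <= n)%N) (hp : (1 <= p)%N)
  (X : 'I_n -> 'cV[R]_p) (Y : 'I_n -> R)
  (psi : R -> R)
  (psi_diff : forall t : R, derivable psi t 1)
  (psi_convex : convex_function (E := R^o) [set: R^o] psi)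
  (betastar : 'cV[R]_p)
  (lambda : R) (lambda_gt0 : 0 < lambda)
  (h : R -> R)
  (h_convex : convex_function (E := R^o) [set: R^o] h)
  (h_diff : forall t : R, derivable h t 1)
  (h_i : (ereal_sup [set (`|derive1 h t|)%:E | t in [set: R]] <= lambda%:E)%E)
  (h_ii : forall t : R, h (- t) = h t)
  (h_iii_mono : forall t1 t2 : R, t1 <= t2 -> derive1 h t1 <= derive1 h t2)
  (eta_minus eta_plus : R)
  (eta_order : 0 <= eta_plus <= eta_minus)
  (h_iii_slope : forall t1 t2 : R, t1 < t2 ->
     eta_plus <= (derive1 h t2 - derive1 h t1) / (t2 - t1) <= eta_minus)
  (h_iv : h 0 = 0 /\ derive1 h 0 = 0)
  (betahat : 'cV[R]_p) :
  let L : 'cV[R]_p -> R := glm_loss X Y psi in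
  let S : {set 'I_p} := supp betastar in
  forall
  (betahat_stationary : d_stationary (penalized_loss L lambda h) betahat)
  (c : R) (hc : 0 < c < 1)
  (h_a : linfnorm (gradient L betastar) <= lambda / 8)
  (h_b : \big[Num.max/0]_(j in (~: S)%SET) `|derive1 h (betahat j 0)|
         <= (1 - c) * lambda)
  (gamma : R) (gamma_gt0 : 0 < gamma)
  (h_c : forall b1 b2 : 'cV[R]_p, cone S c (b1 - b2) ->
     L b1 >= L b2 + dotv (gradient L b2) (b1 - b2)
             + gamma / 2 * l2norm (b1 - b2) ^+ 2)
  (h_d : gamma > eta_minus)
  (h_e : linfnorm (n%:R^-1 *: \sum_(i < n)
           (derive1 psi (dotv (X i) betastar) *: X i - Y i *: X i))
         <= c * lambda / 2),
  l2norm (betastar - betahat)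
    <= 17 * lambda / (8 * (gamma - eta_minus)) * Num.sqrt (#|S|%:R).
Proof.
move=> L S hst c hc h_a h_b gamma gamma_gt0 h_c h_d h_e.
have [c0 c1] := andP hc.
set D := betahat - betastar.
set g := gradient L betastar.
have dh_le t : `|derive1 h t| <= lambda.
  by rewrite -lee_fin; apply: le_trans h_i; apply: ereal_sup_ubound; exists t.
have dh_Sc j : j \notin S -> `|derive1 h (betahat j 0)| <= (1 - c) * lambda.
  move=> jS; apply: le_trans h_b.
  by apply: (le_bigmax_cond _ (fun j => `|derive1 h (betahat j 0)|)); rewrite inE.
have betastar_Sc j : j \notin S -> betastar j 0 = 0.
  by rewrite inE negbK => /eqP.
have g_le8 j : `|g j 0| <= lambda / 8 := le_trans (abs_coord_le_linfnorm _ _) h_a.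
have g_le2 j : `|g j 0| <= c * lambda / 2.
  by apply: le_trans h_e; rewrite /g /L gradient_glm_loss// abs_coord_le_linfnorm.
have gD_bound j (k : R) : `|g j 0| <= k -> - (g j 0 * D j 0) <= k * `|D j 0|.
  move=> gk; apply: le_trans (ler_wpM2r (normr_ge0 _) gk).
  by rewrite -normrM -normrN ler_norm.
have l1_bound j : `|betastar j 0| - `|betahat j 0| <= `|D j 0|.
  by apply: le_trans (lerB_dist _ _) _; rewrite distrC !mxE.
have hD_bound t (k : R) j : `|derive1 h t| <= k ->
    derive1 h t * D j 0 <= k * `|D j 0|.
  move=> hk; apply: le_trans (ler_wpM2r (normr_ge0 _) hk).
  by rewrite -normrM ler_norm.
(* Off [S] the l1 difference is exactly [- |D_j|]; this negative term absorbs the others there. *)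
have l1_Sc j : j \notin S -> `|betastar j 0| - `|betahat j 0| = - `|D j 0|.
  by move=> /betastar_Sc s0; rewrite !mxE s0 normr0 oppr0 addr0 sub0r.
pose T j := - (g j 0 * D j 0) + lambda * (`|betastar j 0| - `|betahat j 0|)
  + derive1 h (betahat j 0) * D j 0.
have stat_sum : dotv (gradient L betahat) D - dotv g D <= \sum_j T j.
  have := d_stationary_ineq X Y psi psi_diff lambda h betahat betastar
    (ltW lambda_gt0) h_diff hst.
  rewrite -/L !dotvB.
  have -> : \sum_(j < p) derive1 h (betahat j 0) * (betastar j 0 - betahat j 0)
      = - \sum_(j < p) derive1 h (betahat j 0) * D j 0.
    by rewrite -sumrN; apply: eq_bigr => j _; rewrite !mxE; ring.
  rewrite /T !big_split /= sumrN -/(dotv g D) -mulr_sumr sumrB.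
  rewrite -/(l1norm betastar) -/(l1norm betahat) !dotvB; lra.
have coneD : cone S c D.
  rewrite /cone /= !l1norm_subvec.
  have : 0 <= \sum_j T j.
    apply: le_trans stat_sum.
    exact: gradient_glm_loss_monotone.
  rewrite (bigID (mem S)) /=.
  (* The gradient, the l1 term and [h'] contribute c/2 + 1 + 1 = (4 + c)/2. *)
  have TS : \sum_(j in S) T j <=
      (4 + c) / 2 * lambda * \sum_(j in S) `|D j 0|.
    rewrite mulr_sumr; apply: ler_sum => j jS.
    have := gD_bound j _ (g_le2 j).
    have := hD_bound _ _ j (dh_le (betahat j 0)).
    have := ler_wpM2l (ltW lambda_gt0) (l1_bound j).
    rewrite /T; lra.
  (* Here the contributions are c/2 - 1 + (1 - c) = - c/2, by (b) and [l1_Sc]. *)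
  have TSc : \sum_(j | j \notin S) T j <=
      - (c / 2 * lambda * \sum_(j in ~: S) `|D j 0|).
    rewrite [in leRHS](eq_bigl (fun j => j \notin S)); last first.
      by move=> j; rewrite inE.
    rewrite mulr_sumr -sumrN; apply: ler_sum => j jS.
    have := gD_bound j _ (g_le2 j).
    have := hD_bound _ _ j (dh_Sc j jS).
    rewrite /T l1_Sc//; lra.
  move=> T0.
  rewrite mulrAC ler_pdivlMr// -(ler_pM2l (_ : 0 < lambda / 2)) ?divr_gt0//.
  lra.
have coneND : cone S c (betastar - betahat).
  move: coneD; rewrite /cone /= !l1norm_subvec.
  have E (A : {set 'I_p}) : \sum_(j in A) `|D j 0|
      = \sum_(j in A) `|(betastar - betahat) j 0|.
    by apply: eq_bigr => j _; rewrite !mxE distrC.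
  by rewrite !E.
set N := l2norm (betastar - betahat).
have N0 : 0 <= N by apply: sqrtr_ge0.
have sqN : N ^+ 2 = \sum_j D j 0 ^+ 2.
  rewrite sqr_sqrtr; last by apply: sumr_ge0 => j _; rewrite sqr_ge0.
  by apply: eq_bigr => j _; rewrite !mxE; ring.
have sqD : l2norm D ^+ 2 = N ^+ 2.
  by rewrite sqN sqr_sqrtr//; apply: sumr_ge0 => j _; rewrite sqr_ge0.
(* Adding the inequalities for [D] and its opposite cancels the values of [L] and doubles
   [gamma / 2]. *)
have strong : gamma * N ^+ 2 <= \sum_j T j.
  apply: le_trans stat_sum.
  have := h_c _ _ coneND; have := h_c _ _ coneD.
  rewrite -/D -/N sqD -/g !dotvB; lra.
(* The slope bound assumes ordered points; swapping them changes the sign of both factors on the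
   left, so the sign of [D_j] is immaterial. *)
have slope_h j : (derive1 h (betahat j 0) - derive1 h (betastar j 0)) * D j 0
    <= eta_minus * D j 0 ^+ 2.
  have le_slope t1 t2 : t1 < t2 ->
      (derive1 h t2 - derive1 h t1) * (t2 - t1) <= eta_minus * (t2 - t1) ^+ 2.
    move=> t12; have [_] := andP (h_iii_slope _ _ t12).
    rewrite ler_pdivrMr ?subr_gt0// expr2 mulrA => ?.
    by rewrite ler_wpM2r// subr_ge0 ltW.
  rewrite !mxE.
  have [lt|lt|->] := ltgtP (betastar j 0) (betahat j 0).
  - exact: le_slope.
  - have := le_slope _ _ lt; lra.
  - by rewrite !subrr mulr0 expr0n mulr0.
(* On [S] the coefficients add to 1/8 + 1 + 1 = 17/8. Off [S], [h'] vanishes at [betastar_j = 0],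
   and 1/8 - 1 is negative. *)
have T_le j : T j <= eta_minus * D j 0 ^+ 2
    + (if j \in S then 17 / 8 * lambda * `|D j 0| else 0).
  have := slope_h j; have := gD_bound j _ (g_le8 j); rewrite /T.
  have := mulr_ge0 (ltW lambda_gt0) (normr_ge0 (D j 0)).
  have [jS|jS] := boolP (j \in S).
    have := hD_bound _ _ j (dh_le (betastar j 0)).
    have := ler_wpM2l (ltW lambda_gt0) (l1_bound j).
    lra.
  rewrite l1_Sc// betastar_Sc// (proj2 h_iv); lra.
have main : (gamma - eta_minus) * N ^+ 2
    <= 17 / 8 * lambda * (Num.sqrt #|S|%:R * N).
  have l1S : \sum_(j in S) `|D j 0| <= Num.sqrt #|S|%:R * N.
    apply: le_trans (sum_normr_le_sqrt S (fun j => D j 0)) _.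
    rewrite ler_wpM2l ?sqrtr_ge0// -(ger0_norm N0) -sqrtr_sqr ler_wsqrtr//.
    rewrite sqN [leRHS](bigID (mem S)) /= lerDl.
    by apply: sumr_ge0 => j _; rewrite sqr_ge0.
  have := le_trans strong (ler_sum _ (fun j _ => T_le j)).
  rewrite big_split /= -mulr_sumr -sqN -big_mkcond -mulr_sumr /= => le1.
  have := ler_wpM2l (_ : 0 <= 17 / 8 * lambda) l1S.
  by rewrite mulr_ge0// ?(ltW lambda_gt0)// => /(_ isT); lra.
have gap_gt0 : 0 < gamma - eta_minus by rewrite subr_gt0.
(* The case [N = 0] is separate because [main] is divided by [N]. *)
have [->|N_neq0] := eqVneq N 0.
  by rewrite mulr_ge0 ?sqrtr_ge0// divr_ge0// mulr_ge0// ltW.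
have Ngt0 : 0 < N by rewrite lt_def N_neq0.
have {}main : (gamma - eta_minus) * N <= 17 / 8 * lambda * Num.sqrt #|S|%:R.
  by rewrite -(ler_pM2r Ngt0); move: main; lra.
rewrite mulrAC ler_pdivlMr ?mulr_gt0//.
by move: main; lra.
Qed.
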